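(* Let $X$ be a real valued and adapted process which is continuous in probability. Suppose that $T>0$ and $f:[0,T]\times\mathbb{R}\to\mathbb{R}$ is such that locally $f(t,x)$ is uniformly continuous in $x$, and $(f(t,X_t))_{t\in[0,T]}$ is a martingale. Then $f$ is jointly continuous on the marginal support of $X$, that is, $f$ is continuous at every point $(t,x)\in\mathrm{MSupp}(X)$ with $t\in[0,T]$.
   Context: The process $X$ is indexed by $\mathbb{R}_+=[0,\infty)$ and defined on a filtered probability space $(\Omega,\mathcal{F},(\mathcal{F}_t)_{t\in\mathbb{R}_+},\mathbb{P})$. ''Locally $f(t,x)$ is uniformly continuous in $x$'' means that $f$ is uniformly continuous in $x$ on every bounded subset of $[0,T]\times\mathbb{R}$: for every bounded $B\subseteq[0,T]\times\mathbb{R}$ and $\varepsilon>0$ there is $\delta>0$ such that $|f(t,x)-f(t,y)|<\varepsilon$ whenever $(t,x),(t,y)\in B$ and $|x-y|<\delta$. Support: for a real valued random variable $V$, $\mathrm{Supp}(V)$ is the smallest closed subset of $\mathbb{R}$ with $\mathbb{P}(V\in\mathrm{Supp}(V))=1$. Marginal support: $\mathrm{MSupp}(X)=\{(t,x)\in\mathbb{R}_+\times\mathbb{R}: x\in\mathrm{Supp}(X_t)\}$. *)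

(* Defs.v *)
From HB Require Import structures.
From mathcomp Require Import all_boot all_order all_algebra.
From mathcomp Require Import all_classical all_reals all_analysis.
From mathcomp Require Import measurable_realfun.
Set Implicit Arguments.
Unset Strict Implicit.
Unset Printing Implicit Defensive.
Import Order.TTheory GRing.Theory Num.Theory.
Import numFieldNormedType.Exports.
Local Open Scope classical_set_scope.
Local Open Scope ring_scope.

(* Processes and filtrations are indexed by the whole of R, but only the times
   in [0, +oo[ (or in the given time set) are ever constrained or used: values
   at other times are junk. *)

Definition is_filtration d (Omega : measurableType d) (R : realType)
    (F : R -> set (set Omega)) : Prop :=
  (forall t, 0 <= t -> sigma_algebra setT (F t) /\ F t `<=` measurable) /\
  (forall s t, 0 <= s -> s <= t -> F s `<=` F t).

Definition measurable_wrt d (Omega : measurableType d) (R : realType)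
    (G : set (set Omega)) (Y : Omega -> R) : Prop :=
  measurable_fun setT (Y : g_sigma_algebraType G -> R).

Definition adapted d (Omega : measurableType d) (R : realType)
    (F : R -> set (set Omega)) (I : set R) (Y : R -> Omega -> R) : Prop :=
  forall t, I t -> measurable_wrt (F t) (Y t).

(* Z is a version of the conditional expectation E[Y | G]. *)
Definition is_condexp d (Omega : measurableType d) (R : realType)
    (P : probability Omega R) (G : set (set Omega)) (Y Z : Omega -> R) : Prop :=
  [/\ measurable_wrt G Z,
      P.-integrable setT (EFin \o Z) &
      forall A, G A ->
        (\int[P]_(w in A) (Z w)%:E = \int[P]_(w in A) (Y w)%:E)%E].

Definition martingale d (Omega : measurableType d) (R : realType)
    (P : probability Omega R) (F : R -> set (set Omega)) (I : set R)
    (M : R -> Omega -> R) : Prop :=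
  [/\ adapted F I M,
      forall t, I t -> P.-integrable setT (EFin \o M t) &
      forall s t, I s -> I t -> s <= t -> is_condexp P (F s) (M t) (M s)].

Definition continuous_in_probability d (Omega : measurableType d)
    (R : realType) (P : probability Omega R) (X : R -> Omega -> R) : Prop :=
  forall t, 0 <= t -> forall e, 0 < e ->
    P [set w | e < `|X s w - X t w|]
      @[s --> within [set s | 0 <= s] (nbhs t)] --> 0%E.

(* smallest C set0 is the intersection of all members of C; supp_closed and
   supp_prob1 show that here it is itself a member. *)
Definition supp d (Omega : measurableType d) (R : realType)
    (P : probability Omega R) (V : Omega -> R) : set R :=
  smallest [set C | closed C /\ P (V @^-1` C) = 1%E] set0.

Definition marginal_support d (Omega : measurableType d) (R : realType)
    (P : probability Omega R) (X : R -> Omega -> R) : set (R * R) :=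
  [set z | 0 <= z.1 /\ supp P (X z.1) z.2].

Definition locally_unif_continuous_in_x (R : realType) (T : R)
    (f : R -> R -> R) : Prop :=
  forall B : set (R * R), B `<=` `[0, T] `*` setT -> bounded_set B ->
  forall e, 0 < e -> exists2 delta, 0 < delta &
    forall t x y, B (t, x) -> B (t, y) -> `|x - y| < delta ->
      `|f t x - f t y| < e.

Lemma supp_closed d (Omega : measurableType d) (R : realType)
  (P : probability Omega R) (V : Omega -> R) : closed (supp P V).
Proof. by apply: closed_bigI => C [[]]. Qed.

Lemma supp_prob1 d (Omega : measurableType d) (R : realType)
  (P : probability Omega R) (V : Omega -> R) :
  measurable_fun setT V -> P (V @^-1` supp P V) = 1%E.
Proof.
move=> mV.
have mpre A : measurable A -> measurable (V @^-1` A).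
  by move=> mA; rewrite -[X in measurable X]setTI; exact: mV.
have mS : measurable (supp P V) by apply: closed_measurable; exact: supp_closed.
suff : P.-negligible (V @^-1` (~` supp P V)).
  have mSC := mpre _ (measurableC mS).
  move=> /(negligibleP _ mSC) N0.
  by rewrite -[V @^-1` _]setCK probability_setC // N0 sube0.
pose J n : set R := if unpickle n is Some p then
  `](ratr (p : rat * rat).1), (ratr p.2)[%classic else set0.
have mJ n : measurable (J n) by rewrite /J; case: unpickle.
pose K n := if P (V @^-1` J n) == 0%E then V @^-1` J n else set0.
apply: (@negligibleS _ _ _ _ (\bigcup_n K n)); last first.
  apply: negligible_bigcup => n; rewrite /K; case: eqP => [J0|_].
    by apply/negligibleP => //; exact: mpre.
  exact: negligible_set0.
move=> w /= /existsNP[C /not_implyP[[[cC PC] _] /= CVw]].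
have : nbhs (V w) (~` C) by apply: open_nbhs_nbhs; split => //; exact: closed_openC.
rewrite -nbhs_ballE => -[e /= e0 eC].
have /rat_in_itvoo[p /itvP pe] : V w - e < V w by rewrite gtrBl.
have /rat_in_itvoo[q /itvP qe] : V w < V w + e by rewrite ltrDl.
exists (pickle (p, q)) => //; rewrite /K.
have -> : J (pickle (p, q)) = `](ratr p), (ratr q)[%classic.
  by rewrite /J pickleK.
case: eqP => [_|]; first by rewrite /= in_itv/= pe qe.
case; apply/eqP; rewrite -measure_le0.
have PC0 : P (V @^-1` (~` C)) = 0%E.
  have := probability_setC P (mpre _ (closed_measurable cC)).
  by rewrite PC subee.
rewrite -PC0; apply: le_measure; rewrite ?inE.
- exact: mpre.
- by apply: mpre; apply: measurableC; exact: closed_measurable.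
move=> v /=; rewrite in_itv/= => /andP[pv vq]; apply: eC.
rewrite /ball/= distrC ltr_distl (lt_trans _ pv) ?pe//=.
by rewrite (lt_trans vq)// qe.
Qed.

(* Main.v *)
Require Import Defs.
From HB Require Import structures.
From mathcomp Require Import all_boot all_order all_algebra.
From mathcomp Require Import all_classical all_reals all_analysis.
From mathcomp Require Import measurable_realfun ring lra.
Set Implicit Arguments.
Unset Strict Implicit.
Unset Printing Implicit Defensive.
Import Order.TTheory GRing.Theory Num.Theory.
Import numFieldNormedType.Exports.
Local Open Scope classical_set_scope.
Local Open Scope ring_scope.

(** The modulus of continuity of f in x is uniform in time, so it is enough to
    control f s x - f t x at the fixed x as s tends to t.  This is obtained by
    testing the martingale property on a single event.

    Let u <= v be the two times s and t in increasing order, and let A be the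
    event that X u is within delta of x; it belongs to F u, so M u = f u (X u)
    and M v = f v (X v) have the same integral over A
    ([condexp_Rintegral_eq]).  On A, M u is close to f u x.  If moreover X u
    and X v are close to each other, then X v is near x too and M v is close
    to f v x.  The exceptional event D where X u and X v are far apart has
    small probability by continuity in probability, and M v, which is a
    conditional expectation of M T, belongs to a uniformly integrable family
    ([condexp_uniformly_integrable]), so D contributes little.  Comparing the
    two integrals ([equal_integrals_gap_bound]) bounds |f v x - f u x| P(A) by
    a small multiple of P(A) plus errors that vanish as s tends to t.  Finally
    P(A) stays away from 0 because x lies in the support of X t
    ([supp_ball_gt0]), which allows dividing by it. *)

(** * Real integrals and probabilities *)

Lemma integrable_normr d (T : measurableType d) (R : realType)
    (mu : {measure set T -> \bar R}) (D : set T) (f : T -> R) :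
  mu.-integrable D (EFin \o f) ->
  mu.-integrable D (EFin \o (fun w => `|f w|)).
Proof. by move/integrable_abse. Qed.

Lemma Rintegral_setID d (T : measurableType d) (R : realType)
    (mu : {measure set T -> \bar R}) (A B : set T) (f : T -> R) :
  measurable A -> measurable B -> mu.-integrable A (EFin \o f) ->
  \int[mu]_(w in A) f w =
    \int[mu]_(w in A `&` B) f w + \int[mu]_(w in A `\` B) f w.
Proof.
move=> mA mB fi; rewrite -Rintegral_setU ?setUIDK //.
- exact: measurableI.
- exact: measurableD.
- by rewrite disj_set2E; apply/eqP; rewrite setDE setIACA setICr setI0.
Qed.

Lemma le_Rintegral_subset d (T : measurableType d) (R : realType)
    (mu : {measure set T -> \bar R}) (A B : set T) (f : T -> R) :
  measurable A -> measurable B -> A `<=` B -> mu.-integrable B (EFin \o f) ->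
  (forall w, 0 <= f w) ->
  \int[mu]_(w in A) f w <= \int[mu]_(w in B) f w.
Proof.
move=> mA mB AB fi f0; rewrite (Rintegral_setID mB mA fi) (setIidr AB) lerDl.
exact: Rintegral_ge0.
Qed.

Lemma fine_probability_le d (T : measurableType d) (R : realType)
    (P : probability T R) (A B : set T) :
  measurable A -> measurable B -> A `<=` B -> fine (P A) <= fine (P B).
Proof.
move=> mA mB AB; apply: fine_le; rewrite ?fin_num_measure//.
by apply: le_measure; rewrite ?inE.
Qed.

Lemma preimage_ballE (T : Type) (R : realType) (V : T -> R) (x e : R) :
  [set w | `|V w - x| < e] = V @^-1` ball x e.
Proof. by apply/seteqP; split=> w; rewrite /ball/= distrC. Qed.

Lemma measurable_preimage_ball d (T : measurableType d) (R : realType)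
    (V : T -> R) (x e : R) :
  measurable_fun setT V -> measurable [set w | `|V w - x| < e].
Proof.
move=> mV; rewrite preimage_ballE -[X in measurable X]setTI; apply: mV => //.
by apply: open_measurable; exact: ball_open.
Qed.

(** * Conditional expectations *)

Lemma measurable_wrt_preimage d (Omega : measurableType d) (R : realType)
    (G : set (set Omega)) (Y : Omega -> R) (B : set R) :
  sigma_algebra setT G -> measurable_wrt G Y -> measurable B -> G (Y @^-1` B).
Proof.
move=> sG mY mB; rewrite -(sigma_algebra_id sG).
by have := mY measurableT B mB; rewrite setTI.
Qed.

Lemma measurable_wrt_measurable d (Omega : measurableType d) (R : realType)
    (G : set (set Omega)) (Y : Omega -> R) :
  sigma_algebra setT G -> G `<=` measurable -> measurable_wrt G Y ->
  measurable_fun setT Y.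
Proof.
move=> sG Gm mY _ B mB; rewrite setTI.
by apply: Gm; exact: measurable_wrt_preimage mB.
Qed.

Lemma condexp_Rintegral_eq d (Omega : measurableType d) (R : realType)
    (P : probability Omega R) (G : set (set Omega)) (Y Z : Omega -> R) A :
  is_condexp P G Y Z -> G A ->
  \int[P]_(w in A) Z w = \int[P]_(w in A) Y w.
Proof. by case=> _ _ YZ GA; rewrite /Rintegral YZ. Qed.

(** Splitting A according to the sign of Z, which is an event of G, reduces the
    claim to events on which |Z| integrates to plus or minus the integral of Z,
    hence of Y. *)
Lemma condexp_contraction d (Omega : measurableType d) (R : realType)
    (P : probability Omega R) (G : set (set Omega)) (Y Z : Omega -> R) A :
  sigma_algebra setT G -> G `<=` measurable ->
  P.-integrable setT (EFin \o Y) -> is_condexp P G Y Z -> G A ->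
  \int[P]_(w in A) `|Z w| <= \int[P]_(w in A) `|Y w|.
Proof.
move=> sG Gm Yi YZ GA; have [mZ Zi _] := YZ.
have [GT GD _ GI] := (sigma_algebraP (fun X _ => @subsetT _ X)).1 sG.
pose B := Z @^-1` `[0, +oo[.
have GB : G B by exact: measurable_wrt_preimage sG mZ (measurable_itv _).
have GAB : G (A `&` B) by exact: GI.
have GADB : G (A `\` B).
  rewrite setDE; apply: GI => //.
  by rewrite -setTD; exact: GD.
have onS S h : G S -> P.-integrable setT (EFin \o h) ->
    P.-integrable S (EFin \o h).
  by move=> /Gm mS; apply: integrableS.
have onS_norm S h : G S -> P.-integrable setT (EFin \o h) ->
    P.-integrable S (EFin \o (fun w => `|h w|)).
  by move=> GS hi; apply: integrable_normr; exact: onS.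
rewrite (Rintegral_setID (Gm _ GA) (Gm _ GB) (onS_norm _ _ GA Zi)).
rewrite (Rintegral_setID (Gm _ GA) (Gm _ GB) (onS_norm _ _ GA Yi)).
apply: lerD.
  rewrite (@eq_Rintegral _ _ _ _ _ Z); last first.
    move=> w; rewrite inE => -[_]; rewrite /B/= in_itv/= andbT => Z0.
    by rewrite ger0_norm.
  rewrite (condexp_Rintegral_eq YZ GAB) (le_trans (ler_norm _))//.
  by apply: le_normr_Rintegral; [exact: Gm|exact: onS].
rewrite (@eq_Rintegral _ _ _ _ _ (fun w => -1 * Z w)); last first.
  move=> w; rewrite inE => -[_]; rewrite /B/= in_itv/= andbT => /negP Z0.
  by rewrite mulN1r ltr0_norm// ltNge.
rewrite RintegralZl; [|exact: Gm|exact: onS].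
rewrite mulN1r (condexp_Rintegral_eq YZ GADB) (le_trans (ler_norm _))// normrN.
by apply: le_normr_Rintegral; [exact: Gm|exact: onS].
Qed.

(** All conditional expectations Z of Y share one modulus eta: the part of D
    where |Z| < L costs at most L P(D), and on the G-event B where |Z| >= L the
    contraction replaces |Z| by |Y|, whose integral is small because P(B) is at
    most E|Y| / L by Markov's inequality. *)
Lemma condexp_uniformly_integrable d (Omega : measurableType d) (R : realType)
    (P : probability Omega R) (Y : Omega -> R) (e : R) :
  P.-integrable setT (EFin \o Y) -> 0 < e ->
  exists2 eta, 0 < eta & forall (G : set (set Omega)) (Z : Omega -> R) D,
    sigma_algebra setT G -> G `<=` measurable -> is_condexp P G Y Z ->
    measurable D -> fine (P D) < eta -> \int[P]_(w in D) `|Z w| < e.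
Proof.
move=> Yi e0.
have [r [r0 Yr]] := integral_normr_continuous Yi (divr_gt0 e0 (ltr0n R 2)).
pose I := \int[P]_w `|Y w|.
have I0 : 0 <= I by exact: Rintegral_ge0.
(* I + 1 rather than I gives P(B) < r strictly, and L > 0 even if Y = 0 *)
pose L := (I + 1) / r.
have L0 : 0 < L by rewrite divr_gt0// ltr_wpDl.
exists (e / 2 / L); first by rewrite divr_gt0// divr_gt0.
move=> G Z D sG Gm YZ mD PD.
have [mZ Zi _] := YZ.
pose B := (fun w => `|Z w|) @^-1` `[L, +oo[.
have GB : G B.
  suff -> : B = Z @^-1` (Num.norm @^-1` `[L, +oo[).
    apply: (measurable_wrt_preimage sG mZ).
    rewrite -[X in measurable X]setTI.
    by apply: (@normr_measurable R setT) => //; exact: measurable_itv.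
  by [].
have mB := Gm _ GB.
have GT : G setT by rewrite -[setT]setD0; case: sG => G0 GD _; exact: GD.
have Zni : P.-integrable setT (EFin \o (fun w => `|Z w|)).
  exact: integrable_normr.
have on S : measurable S -> P.-integrable S (EFin \o (fun w => `|Z w|)).
  by move=> mS; apply: integrableS Zni.
have PB : (P B < r%:E)%E.
  have LPB : L * fine (P B) <= I.
    rewrite /I (le_trans _ (condexp_contraction sG Gm Yi YZ GT))//.
    rewrite -Rintegral_cst//.
    apply: (@le_trans _ _ (\int[P]_(w in B) `|Z w|)); last first.
      exact: le_Rintegral_subset.
    apply: le_Rintegral => //; [|exact: on|].
      exact: finite_measure_integrable_cst.
    by move=> w; rewrite /B/= in_itv/= andbT.
  rewrite -(@fineK _ (P B)) ?fin_num_measure// lte_fin.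
  rewrite -(ltr_pM2l L0) (le_lt_trans LPB)// /L divfK ?gt_eqF//.
  by rewrite ltrDl.
rewrite (Rintegral_setID mD mB (on _ mD)) [ltRHS](splitr e) addrC.
apply: ltr_leD; last first.
  apply: (@le_trans _ _ (\int[P]_(w in B) `|Z w|)).
    by apply: le_Rintegral_subset => //; [exact: measurableI|exact: on].
  rewrite (le_trans (condexp_contraction sG Gm Yi YZ GB))// ltW//.
  exact: Yr.
apply: (@le_lt_trans _ _ (\int[P]_(w in D `\` B) L)).
  apply: le_Rintegral; [exact: measurableD|by apply: on; exact: measurableD|..] => //.
    by apply: finite_measure_integrable_cst; exact: measurableD.
  move=> w [_]; rewrite /B/= in_itv/= andbT => /negP.
  by rewrite -ltNge => /ltW.
rewrite Rintegral_cst; last exact: measurableD.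
rewrite mulrC -ltr_pdivlMr// (le_lt_trans _ PD)//.
by apply: fine_probability_le => //; exact: measurableD.
Qed.

(** * Comparing f at two times *)

(** If the ball had probability 0, its complement would be a closed set of
    probability 1, hence would contain x. *)
Lemma supp_ball_gt0 d (Omega : measurableType d) (R : realType)
    (P : probability Omega R) (V : Omega -> R) (x e : R) :
  measurable_fun setT V -> supp P V x -> 0 < e ->
  0 < fine (P [set w | `|V w - x| < e]).
Proof.
move=> mV suppx e0; pose B := [set w | `|V w - x| < e].
have mB : measurable B by exact: measurable_preimage_ball.
rewrite lt_neqAle fine_ge0 ?measure_ge0// andbT; apply/negP => /eqP PB0.
have PB : P B = 0%E by rewrite -(@fineK _ (P B)) ?fin_num_measure// -PB0.
have cC : closed (~` ball x e) by apply: open_closedC; exact: ball_open.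
have PC : P (V @^-1` (~` ball x e)) = 1%E.
  by rewrite -preimage_setC -preimage_ballE probability_setC// PB sube0.
have := suppx (~` ball x e) (conj (conj cC PC) (@sub0set _ _)); apply.
exact: ballxx.
Qed.

(** With G = g(U) - g x and H = h(V) - h x, equality of the integrals over A
    says that (h x - g x) P(A) is the integral of G - H over A.  On A, |G|
    is at most e; |H| is at most e off D, where V is within 2 delta of x, and is
    bounded crudely by |h(V)| + |h x| on D.  Only h(V), at the later time in the
    application, has to be controlled on D. *)
Lemma equal_integrals_gap_bound d (Omega : measurableType d) (R : realType)
    (P : probability Omega R) (U V : Omega -> R) (g h : R -> R)
    (x e delta : R) (D : set Omega) :
  0 < delta -> measurable_fun setT U ->
  P.-integrable setT (EFin \o (g \o U)) ->
  P.-integrable setT (EFin \o (h \o V)) ->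
  (forall y, `|y - x| < 2 * delta -> `|g y - g x| <= e) ->
  (forall y, `|y - x| < 2 * delta -> `|h y - h x| <= e) ->
  measurable D -> (forall w, ~ D w -> `|V w - U w| <= delta) ->
  let A := [set w | `|U w - x| < delta] in
  \int[P]_(w in A) g (U w) = \int[P]_(w in A) h (V w) ->
  `|h x - g x| * fine (P A) <=
    2 * e * fine (P A) + \int[P]_(w in D) `|h (V w)| + `|h x| * fine (P D).
Proof.
move=> delta0 mU gi hi gx hx mD DUV A AE.
have mA : measurable A by exact: measurable_preimage_ball.
have cst_int S (k : R) : measurable S -> P.-integrable S (EFin \o (fun=> k)).
  exact: finite_measure_integrable_cst.
have on S k : measurable S -> P.-integrable setT (EFin \o k) ->
    P.-integrable S (EFin \o k).
  by move=> mS; apply: integrableS.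
pose G w := g (U w) - g x; pose H w := h (V w) - h x.
have Gi : P.-integrable setT (EFin \o G).
  exact: (integrableB measurableT gi (cst_int _ (g x) measurableT)).
have Hi : P.-integrable setT (EFin \o H).
  exact: (integrableB measurableT hi (cst_int _ (h x) measurableT)).
have Hni := integrable_normr Hi; have Gni := integrable_normr Gi.
have eqI : (h x - g x) * fine (P A) =
    \int[P]_(w in A) G w - \int[P]_(w in A) H w.
  rewrite !RintegralB//; try by [exact: on|exact: cst_int].
  by rewrite !Rintegral_cst// AE; ring.
have mAD := measurableI _ _ mA mD; have mADC := measurableD mA mD.
have GA : \int[P]_(w in A) `|G w| <= e * fine (P A).
  rewrite -Rintegral_cst//; apply: le_Rintegral => //; [exact: on|exact: cst_int|].
  move=> w Aw; apply: gx; apply: lt_trans (Aw : _ < delta) _.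
  by rewrite mulr_natl mulr2n ltrDl.
have HADC : \int[P]_(w in A `\` D) `|H w| <= e * fine (P (A `\` D)).
  rewrite -Rintegral_cst//; apply: le_Rintegral => //; [exact: on|exact: cst_int|].
  move=> w [Aw Dw]; apply: hx.
  rewrite -[V w](subrK (U w)) -addrA (le_lt_trans (ler_normD _ _))//.
  by rewrite mulr_natl mulr2n; apply: ler_ltD; [exact: DUV|].
have HAD : \int[P]_(w in A `&` D) `|H w| <=
    \int[P]_(w in D) `|h (V w)| + `|h x| * fine (P D).
  apply: (@le_trans _ _ (\int[P]_(w in D) `|H w|)).
    by apply: le_Rintegral_subset => //; exact: on.
  rewrite -Rintegral_cst// -RintegralD//;
    [|by apply: on => //; exact: integrable_normr|exact: cst_int].
  apply: le_Rintegral => //; first exact: on.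
    exact: (integrableD mD (on _ _ mD (integrable_normr hi)) (cst_int _ `|h x| mD)).
  by move=> w _; exact: ler_normB.
have PADC : e * fine (P (A `\` D)) <= e * fine (P A).
  rewrite ler_wpM2l//; last exact: fine_probability_le.
  by apply: (le_trans (normr_ge0 _) (gx x _)); rewrite subrr normr0 mulr_gt0.
rewrite -[X in _ * X](@ger0_norm _ (fine (P A))) ?fine_ge0// -normrM eqI.
rewrite (le_trans (ler_normB _ _))//.
have nG := @le_normr_Rintegral _ _ _ P A G mA (on _ _ mA Gi).
have nH := @le_normr_Rintegral _ _ _ P A H mA (on _ _ mA Hi).
rewrite (Rintegral_setID mA mD (on _ _ mA Hni)) in nH.
lra.
Qed.

(** The bounded set used is [0, T] times a compact interval around x, so that
    delta does not depend on the time s. *)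
Lemma locally_unif_continuous_in_x_at (R : realType) (T : R) (f : R -> R -> R)
    (x e : R) :
  locally_unif_continuous_in_x T f -> 0 < e ->
  exists2 delta, 0 < delta & forall s y, 0 <= s <= T -> `|y - x| < delta ->
    `|f s y - f s x| <= e.
Proof.
move=> ucf e0; pose B := `[0, T]%classic `*` `[x - 1, x + 1]%classic.
have [delta delta0 fB] : exists2 delta, 0 < delta &
    forall t x y, B (t, x) -> B (t, y) -> `|x - y| < delta ->
      `|f t x - f t y| < e.
  apply: ucf => //; first by move=> z [].
  by apply: compact_bounded; apply: compact_setX; exact: segment_compact.
exists (Num.min delta 1) => [|s y sT]; first by rewrite lt_min delta0 ltr01.
rewrite lt_min => /andP[yd y1].
apply/ltW/fB => //; split; rewrite /= ?in_itv//=.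
  by rewrite -ler_distlC distrC ltW.
by rewrite !(gerBl, lerDl) ler01.
Qed.

(** Solving the gap inequality for D.  The value h of f at the later time is not
    bounded in advance when that time is the moving one, but it exceeds the
    value c at the fixed time by at most D, and the resulting term D q is
    absorbed in the left-hand side because q is small compared with a. *)
Lemma gap_le_of_small_error (R : realFieldType) (a p q r e c h D : R) :
  0 < e -> 0 < p -> 0 <= q -> p - q <= a -> q <= p / 8 ->
  r <= e * p / 4 -> c * q <= e * p / 4 -> h <= c + D ->
  D * a <= 2 * e * a + r + h * q -> D <= 4 * e.
Proof.
move=> e0 p0 q0 pqa qp rp cq hc Da; rewrite leNgt; apply/negP => eD.
have : 0 < (D - 4 * e) * (a - q) by rewrite mulr_gt0//; lra.
have : 0 <= e * (2 * a - 4 * q - p / 2) by rewrite mulr_ge0//; lra.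
have : 0 <= (c + D - h) * q by rewrite mulr_ge0//; lra.
lra.
Qed.

Lemma continuous_in_time_on_supp (R : realType) (d : measure_display)
    (Omega : measurableType d) (P : probability Omega R)
    (F : R -> set (set Omega)) (X : R -> Omega -> R) (T : R)
    (f : R -> R -> R) (t x e : R) :
  is_filtration F ->
  adapted F `[0, +oo[ X ->
  continuous_in_probability P X ->
  locally_unif_continuous_in_x T f ->
  martingale P F `[0, T] (fun t w => f t (X t w)) ->
  0 <= t <= T -> supp P (X t) x -> 0 < e ->
  exists2 rho, 0 < rho & forall s, 0 <= s <= T -> `|t - s| < rho ->
    `|f s x - f t x| <= 4 * e.
Proof.
move=> [sF _] aX cX ucf [aM iM cM] /andP[t0 tT] xt e0.
have T0 := le_trans t0 tT.
have mX s : 0 <= s -> measurable_fun setT (X s).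
  move=> s0; have [sFs Fm] := sF _ s0.
  by apply: measurable_wrt_measurable sFs Fm _; apply: aX; rewrite /= in_itv/= s0.
have [delta' delta'0 fx'] := locally_unif_continuous_in_x_at x ucf e0.
pose delta := delta' / 2.
have delta0 : 0 < delta by rewrite divr_gt0.
have fx s y : 0 <= s <= T -> `|y - x| < 2 * delta -> `|f s y - f s x| <= e.
  by move=> sT; rewrite mulrC /delta divfK ?pnatr_eq0//; exact: fx'.
(* A0 uses half the radius, so that A0 is contained in A up to D whichever
   of X s and X t defines A *)
have PA0 := supp_ball_gt0 (mX _ t0) xt (divr_gt0 delta0 (ltr0n R 2)).
set A0 := [set w | _ < _] in PA0; set p := fine (P A0) in PA0.
have mA0 : measurable A0 by apply: measurable_preimage_ball; exact: mX.
have TT : `[0, T]%classic T by rewrite /= in_itv/= T0 lexx.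
have [eta eta0 UI] := condexp_uniformly_integrable (iM _ TT)
  (divr_gt0 (mulr_gt0 e0 PA0) (ltr0n R 4)).
pose c := `|f t x|.
have c1 : 0 < c + 1 by rewrite ltr_wpDl// normr_ge0.
(* q0 collects the smallness required of P(D s): uniform integrability, a
   small share of p, and a negligible term c P(D s) *)
pose q0 := Num.min eta (Num.min (p / 8) (e * p / 4 / (c + 1))).
have q00 : 0 < q0 by rewrite !lt_min eta0 (divr_gt0 PA0)//= !(divr_gt0, mulr_gt0).
have d20 : 0 < delta / 2 by rewrite divr_gt0.
have d2d : delta / 2 < delta by rewrite ltr_pdivrMr// ltr_pMr// ltr1n.
pose D s := [set w | delta / 2 < `|X s w - X t w|].
have mD s : 0 <= s -> measurable (D s).
  move=> s0; rewrite (_ : D s =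
    (fun w => `|X s w - X t w|) @^-1` `]delta / 2, +oo[); last first.
    by rewrite preimage_itvoy.
  rewrite -[X in measurable X]setTI.
  have mXX : measurable_fun setT (fun w => `|X s w - X t w|).
    by apply: measurableT_comp => //; apply: measurable_funB; exact: mX.
  by apply: mXX => //; exact: measurable_itv.
have [rho rho0 PD] : exists2 rho, 0 < rho &
    forall s, 0 <= s -> `|t - s| < rho -> fine (P (D s)) < q0.
  have : \forall s \near within [set s | 0 <= s] (nbhs t), (P (D s) < q0%:E)%E.
    apply: ((cX t t0 _ d20) [set y | (y < q0%:E)%E]).
    by apply: open_ereal_lt'; rewrite lte_fin.
  rewrite near_withinE => /nbhs_ballP[rho /= rho0 H]; exists rho => // s s0 ts.
  rewrite -lte_fin fineK; last by apply: fin_num_measure; exact: mD.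
  exact: H.
exists rho => // s sT ts; have /andP[s0 sT'] := sT.
have tTT : 0 <= t <= T by rewrite t0 tT.
have := PD _ s0 ts; rewrite !lt_min => /and3P[q_eta q_p q_c].
have mDs := mD _ s0.
set q := fine (P (D s)) in q_eta q_p q_c.
(* the argument is the same for s <= t and t < s; u, v are the ordered times *)
have key u v : 0 <= u <= T -> 0 <= v <= T -> u <= v ->
    (forall w, ~ D s w -> `|X v w - X u w| <= delta) ->
    A0 `<=` [set w | `|X u w - x| < delta] `|` D s ->
    `|f v x| <= c + `|f v x - f u x| -> `|f v x - f u x| <= 4 * e.
  move=> uT vT uv Duv A0s fv.
  have [u0 _] := andP uT; have [v0 _] := andP vT.
  have uI : `[0, T]%classic u by rewrite /= in_itv.
  have vI : `[0, T]%classic v by rewrite /= in_itv.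
  have [sFu Fum] := sF _ u0; have [sFv Fvm] := sF _ v0.
  pose A := [set w | `|X u w - x| < delta].
  have FA : F u A.
    rewrite /A preimage_ballE; apply: (measurable_wrt_preimage sFu); last first.
      by apply: open_measurable; exact: ball_open.
    by apply: aX; rewrite /= in_itv/= u0.
  have mA := Fum _ FA.
  have PAD : p - q <= fine (P A).
    rewrite lerBlDr (@le_trans _ _ (fine (P (A `|` D s))))//.
      by apply: fine_probability_le => //; exact: measurableU.
    rewrite -fineD ?fin_num_measure//.
    apply: fine_le; rewrite ?fin_numD ?fin_num_measure//.
      exact: measurableU.
    exact: measureU2.
  have gap := equal_integrals_gap_bound delta0 (mX _ u0) (iM _ uI) (iM _ vI)
    (fun y => fx u y uT) (fun y => fx v y vT) mDs Duv
    (condexp_Rintegral_eq (cM _ _ uI vI uv) FA).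
  have vT' : v <= T by have /andP[] := vT.
  have UIv := UI (F v) _ (D s) sFv Fvm (cM _ _ vI TT vT') mDs q_eta.
  apply: (gap_le_of_small_error e0 PA0 _ PAD (ltW q_p) (ltW UIv) _ fv gap).
    by rewrite fine_ge0// measure_ge0.
  rewrite (@le_trans _ _ ((c + 1) * q))//.
    by rewrite ler_wpM2r ?lerDl// fine_ge0// measure_ge0.
  by rewrite mulrC -ler_pdivlMr// ltW.
have [st|ts'] := leP s t.
- rewrite distrC; apply: key => //.
  + move=> w /= /negP; rewrite -leNgt distrC => /le_trans; apply.
    exact: ltW.
  + move=> w A0w; have [Dw|Dw] := ltP (delta / 2) `|X s w - X t w|.
      by right.
    left; rewrite /= -[X s w](subrK (X t w)) -addrA [ltRHS]splitr.
    by rewrite (le_lt_trans (ler_normD _ _))// ler_ltD.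
  + by rewrite lerDl.
- apply: key => //; first exact: ltW.
  + move=> w /= /negP; rewrite -leNgt => /le_trans; apply.
    exact: ltW.
  + by move=> w /= /lt_trans A0w; left; apply: A0w; exact: d2d.
  + by rewrite -[X in `|X| <= _](subrKC (f t x)) ler_normD.
Qed.

Theorem theorem1p7 (R : realType) (d : measure_display)
    (Omega : measurableType d) (P : probability Omega R)
    (F : R -> set (set Omega)) (X : R -> Omega -> R) (T : R)
    (f : R -> R -> R) :
  is_filtration F ->
  adapted F `[0, +oo[ X ->
  continuous_in_probability P X ->
  0 < T ->
  locally_unif_continuous_in_x T f ->
  martingale P F `[0, T] (fun t w => f t (X t w)) ->
  forall t x : R, 0 <= t <= T -> marginal_support P X (t, x) ->
    f z.1 z.2 @[z --> within (`[0, T] `*` setT) (nbhs (t, x))] --> f t x.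
Proof.
move=> filF aX cX _ ucf Mf t x tT [/= _ xt].
apply/cvgrPdist_le => e e0.
have e8 : 0 < e / 8 by rewrite divr_gt0.
have e2 : 0 < e / 2 by rewrite divr_gt0.
have [rho rho0 ft] := continuous_in_time_on_supp filF aX cX ucf Mf tT xt e8.
have [delta delta0 fx] := locally_unif_continuous_in_x_at x ucf e2.
rewrite near_withinE.
exists (ball t rho, ball x delta); first by split; exact: nbhsx_ballx.
move=> [s y] [/= ts xy] [/= sT _].
rewrite in_itv/= in sT.
rewrite -(subrKA (f s x)) (le_trans (ler_normD _ _))//.
have := ft s sT ts; have := fx s y sT; rewrite distrC => /(_ xy).
rewrite distrC => fxy; rewrite distrC => fts.
lra.
Qed.
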